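(* For every prime number $q$ and every non-negative integer $m$, $$\lim_{n\to\infty}\frac{\#\{\lambda\vdash n \mid v_q(f_\lambda)\leq m+(q-1)\log_q n\}}{p(n)}=0.$$
   Context: Here $\lambda\vdash n$ means that $\lambda$ is a partition of the positive integer $n$, and $p(n)$ denotes the number of partitions of $n$. For a partition $\lambda$ of $n$, $f_\lambda$ denotes the degree (dimension) of the complex irreducible character of the symmetric group $S_n$ corresponding to $\lambda$ under the standard indexing. For a prime $q$ and a nonzero integer $a$, $v_q(a)$ denotes the $q$-adic valuation of $a$, i.e. $q^{v_q(a)}$ is the largest power of $q$ dividing $a$. The logarithm $\log_q$ is to base $q$. *)

(* Defs.v *)
From mathcomp Require Import all_boot all_order all_algebra.
From mathcomp Require Import all_fingroup all_solvable all_field all_character.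

Set Implicit Arguments.
Unset Strict Implicit.
Unset Printing Implicit Defensive.

Import GRing.Theory.
Local Open Scope ring_scope.

Definition is_partn (n : nat) (l : seq nat) : bool :=
  [&& sorted geq l, 0%N \notin l & sumn l == n].

(* A partition of n has at most n parts, each of them at most n, so taking    *)
(* bounded sequences loses nothing and makes intpart n a finType; p(n) is its *)
(* cardinal.                                                                  *)
Definition intpart (n : nat) : finType :=
  {l : n.-bseq 'I_n.+1 | is_partn n (map val l)}.

Definition parts (n : nat) (l : intpart n) : seq nat := map val (val l).

Section Specht.

Variables (n : nat) (l : intpart n).

(* The reference tableau of shape l has the entries 0, ..., n - 1 written     *)
(* row by row, from left to right; these are the coordinates of the entry k.  *)
Definition tab_row (k : 'I_n) : nat := reshape_index (parts l) k.
Definition tab_col (k : 'I_n) : nat := reshape_offset (parts l) k.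

Definition row_stab : {set 'S_n} :=
  [set s : 'S_n | [forall k, tab_row (s k) == tab_row k]].
Definition col_stab : {set 'S_n} :=
  [set s : 'S_n | [forall k, tab_col (s k) == tab_col k]].

Definition Sn_regular := regular_repr algC [group of [set: 'S_n]].

(* The Young symmetrizer, as a row vector of coordinates in the group algebra *)
(* (identified with its image under the regular representation).              *)
Definition young_symmetrizer :=
  gring_row ((\sum_(s in row_stab) Sn_regular s)
             *m (\sum_(s in col_stab) (-1) ^+ s *: Sn_regular s)).

(* The Specht module. MathComp's representations act on the right, so it is   *)
(* the right ideal generated by the Young symmetrizer. The generator          *)
(* (row sum) * (signed column sum) is the polytabloid of the reference        *)
(* tableau: (row sum) * s depends only on the right coset of s modulo         *)
(* row_stab, i.e., on a tabloid of shape l.                                   *)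
Definition specht_repr :=
  submod_repr (cyclic_mx_module Sn_regular young_symmetrizer).

(* The irreducible character of 'S_n attached to l in the standard indexing:  *)
(* the one-row partition gives the trivial character, the one-column          *)
(* partition gives the sign.                                                  *)
Definition specht_char : 'CF([set: 'S_n]) := cfRepr specht_repr.

(* The degree is the value at 1, a natural number of algC, read in nat.       *)
Definition char_degree : nat := Num.truncn (specht_char 1%g).

End Specht.

(* Main.v *)
Require Import Defs.
From mathcomp Require Import all_boot all_order all_algebra.
From mathcomp Require Import all_fingroup all_solvable all_field all_character.
From mathcomp Require Import zify.
Set Implicit Arguments.
Unset Strict Implicit.
Unset Printing Implicit Defensive.

(* Let h be the sum of the first row and the first column lengths of lambda.

   The character of lambda vanishes at every permutation with a cycle longer
   than h. Indeed, for a block D and x in D, the sum of all #|D|-cycles on D is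
     sum_(A c D \ x) (-1)^|A| (signed sum of Sym A) (sum of Sym (D \ A)),
   and if #|D| > h, then A is longer than the first column or D \ A is longer
   than the first row, so that by the pigeonhole principle each term kills the
   Specht module.

   Hence, if Q = q^i > h, the restriction of the character to the group P of
   rotations of k = n / Q disjoint blocks of size Q is supported on the subgroup
   of rotations by multiples of q, which has index q^k in P. As P is abelian,
   q^k divides the degree.

   Choose Q close to n^(7/8). Then k is a power of n, so it exceeds
   m + (q - 1) log_q n, and only the partitions with h >= Q remain. They have a
   first row or first column of length at least M = Q / 2, so there are at most
   2 (n + 1) p(n - M) of them; and p(n - L) <= (2n / L^2) p(n), applied twice with
   L = M / 2, makes this O(n^3 / Q^4) p(n). *)

(** * Orbits, signs and conjugacy of cycles *)

Section PermutationOrbits.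
Local Open Scope group_scope.
Import GRing.Theory.
Variable T : finType.
Implicit Types (s t u : {perm T}) (A B D : {set T}) (x y z : T).

Lemma porbit_stab s x : s \in 'N(porbit s x | 'P).
Proof.
apply/astabsP => y /=; rewrite apermE -!eq_porbit_mem.
by have := porbit_perm s 1 y; rewrite expg1 => ->.
Qed.

Lemma stab_porbit_sub s A x : s \in 'N(A | 'P) -> x \in A -> porbit s x \subset A.
Proof.
move=> sA Ax; apply/subsetP => y /porbitP[i ->]; elim: i => [|i IH].
  by rewrite perm1.
by rewrite expgSr permM -[s _]apermE (astabsP sA).
Qed.

Lemma restr_permU s A B :
    [disjoint A & B] -> s \in 'N(A | 'P) -> s \in 'N(B | 'P) ->
  restr_perm (A :|: B) s = restr_perm A s * restr_perm B s.
Proof.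
move=> dAB sA sB; have sAB : s \in 'N(A :|: B | 'P).
  by apply/astabsP => x; rewrite !inE (astabsP sA) (astabsP sB).
apply/permP => x; rewrite permM.
have [Ax|nAx] := boolP (x \in A).
  rewrite (restr_permE sA Ax) (restr_permE sAB) ?inE ?Ax //.
  rewrite (out_perm (restr_perm_on B s)) //.
  by rewrite (disjointFr dAB) // -[s x]apermE (astabsP sA).
rewrite (out_perm (restr_perm_on A s)) //.
have [Bx|nBx] := boolP (x \in B);
  first by rewrite (restr_permE sB Bx) (restr_permE sAB) ?inE ?Bx ?orbT.
rewrite (out_perm (restr_perm_on B s)) // (out_perm (restr_perm_on _ s)) //.
by rewrite inE negb_or nAx.
Qed.

Lemma porbit_fix s x : s x = x -> porbit s x = [set x].
Proof.
move=> sx; apply/setP => y; rewrite inE; apply/idP/eqP => [|->]; last exact: porbit_id.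
case/porbitP => i ->; elim: i => [|i IH]; first by rewrite perm1.
by rewrite expgSr permM IH.
Qed.

Lemma porbits_restr_porbit s x :
  porbits (restr_perm (porbit s x) s)
    = porbit s x |: [set [set z] | z in ~: porbit s x].
Proof.
set O := porbit s x; set r := restr_perm O s.
have sO : s \in 'N(O | 'P) by apply: porbit_stab.
have rX i : (r ^+ i) x = (s ^+ i) x.
  elim: i => [|i IH]; first by rewrite !perm1.
  by rewrite !expgSr !permM IH restr_permE // mem_porbit.
have rx : porbit r x = O.
  apply/setP => y; apply/porbitP/porbitP => -[i ->]; exists i => //.
have rin z : z \in O -> porbit r z = O.
  by rewrite -rx => ?; apply/eqP; rewrite eq_porbit_mem.
have rout z : z \notin O -> porbit r z = [set z].
  by move=> nz; apply/porbit_fix/(out_perm (restr_perm_on _ _)).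
apply/setP => P; apply/imsetP/setU1P => [[z _ ->]|[->|/imsetP[z]]].
- have [/rin->|nz] := boolP (z \in O); first by left.
  by right; rewrite rout //; apply/imsetP; exists z; rewrite ?inE.
- by exists x.
by rewrite inE => nz ->; exists z; rewrite ?rout.
Qed.

(** With O the orbit of [x], the restriction has 1 + (#|T| - #|O|) orbits on #|T| points. *)
Lemma odd_restr_porbit s x :
  odd_perm (restr_perm (porbit s x) s) = ~~ odd #|porbit s x|.
Proof.
rewrite /odd_perm porbits_restr_porbit cardsU1 card_imset; last exact: set1_inj.
have ->: porbit s x \notin [set [set z] | z in ~: porbit s x].
  apply/imsetP => -[z]; rewrite inE => nz E; move: nz.
  by rewrite E inE eqxx.
rewrite -(cardsC (porbit s x)) !oddD /=.
by case: odd; case: odd.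
Qed.

(* Adding to A, or removing from A, an orbit O of s changes (-1)^|A| by the
   factor (-1)^|O| and the sign of s on A by (-1)^(|O| - 1); hence all terms
   cancel as soon as s has an orbit in D avoiding x. *)
Lemma sum_sign_stab (R : comRingType) D x s :
    x \in D -> perm_on D s ->
  (\sum_(A in powerset (D :\ x) | s \in 'N(A | 'P))
     (-1) ^+ #|A| * (-1) ^+ (restr_perm A s) = (porbit s x == D)%:R :> R)%R.
Proof.
move=> Dx sD.
have sDN : s \in 'N(D | 'P) by apply/astabsP => y; rewrite /= apermE perm_closed.
have sub y : y \in D -> porbit s y \subset D by apply: stab_porbit_sub.
case: eqP => [eqD|/eqP neqD].
  (* A stable [A] with a point in it would contain its orbit [D], hence [x]; only [set0] remains. *)
  rewrite (big_pred1 set0) ?cards0 => [|A].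
    rewrite (_ : restr_perm _ _ = 1) ?odd_perm1 ?mulr1 //.
    by apply/permP => y; rewrite (out_perm (restr_perm_on _ _)) ?inE ?perm1.
  rewrite /= powersetE; apply/andP/eqP => [[AD sA]|->]; last first.
    by split; [apply: sub0set | apply/astabsP => y; rewrite !inE].
  apply/eqP; rewrite -subset0; apply/subsetP => y Ay.
  have := subsetP AD _ Ay; rewrite -eqD => /setD1P[_ yD].
  have := stab_porbit_sub sA Ay; rewrite porbit_sym in yD.
  by move/subsetP => /(_ _ yD) Ax; have := subsetP AD _ Ax; rewrite !inE eqxx.
have [y Dy yx] : exists2 y, y \in D & y \notin porbit s x.
  by apply/subsetPn; apply: contra neqD => ?; rewrite eqEsubset sub.
set O := porbit s y; have sO : s \in 'N(O | 'P) by apply: porbit_stab.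
have xO : x \notin O by rewrite porbit_sym.
rewrite (bigID (fun A => y \in A)) /=.
(* A stable set containing [y] contains all of [O], so adding [O] is a bijection from the stable
   sets without [y] onto those with [y]. *)
rewrite (reindex_onto (fun A => A :|: O) (fun A => A :\: O)) /=; last first.
  move=> A /andP[/andP[_ sA] Ay]; rewrite setUC setDE setUIr setUCr setIT.
  by apply/setUidPr; apply: stab_porbit_sub.
rewrite (eq_bigl (fun A =>
  [&& A \in powerset (D :\ x), s \in 'N(A | 'P) & y \notin A])); last first.
  move=> A; rewrite !powersetE subUset.
  have -> : O \subset D :\ x by rewrite subsetD1 sub.
  have -> : y \in A :|: O by rewrite inE porbit_id orbT.
  rewrite !andbT.
  rewrite setDUl setDv setU0 -andbA.
  have [AD/=|//] := boolP (A \subset D :\ x).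
  have dE : (A :\: O == A) = [disjoint A & O].
    by apply/eqP/idP => [<-|]; [rewrite disjoints_subset subsetDr | move/setDidPl].
  rewrite dE; apply/andP/andP => -[].
    move=> sAO dAO; split; last first.
      by apply/negP => Ay; move: (disjointFr dAO Ay); rewrite porbit_id.
    apply/astabsP => z /=.
    have := astabsP sAO z; have := astabsP sO z; rewrite !inE /=.
    have [zO|nzO] := boolP (z \in O); last by move=> ->; rewrite !orbF.
    by move=> azO _; rewrite (disjointFl dAO zO) (disjointFl dAO azO).
  move=> sA nAy; have dAO : [disjoint A & O].
    rewrite -setI_eq0 -subset0; apply/subsetP => z /setIP[Az zO].
    case/negP: nAy; apply: (subsetP (stab_porbit_sub sA Az)).
    by rewrite porbit_sym.
  split=> //; apply/astabsP => z; rewrite !inE.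
  by rewrite (astabsP sA) (astabsP sO).
apply/eqP; rewrite addr_eq0 -sumrN; apply/eqP; apply: eq_big.
  by move=> A; rewrite andbA.
move=> A /and3P[_ sA nAy].
have dAO : [disjoint A & O].
  rewrite -setI_eq0 -subset0; apply/subsetP => z /setIP[Az zO].
  case/negP: nAy; apply: (subsetP (stab_porbit_sub sA Az)).
  by rewrite porbit_sym.
rewrite restr_permU // odd_permM odd_restr_porbit -/O cardsU.
rewrite (eqP (_ : A :&: O == set0)) ?setI_eq0 // cards0 subn0 exprD signr_addb.
rewrite signrN -(signr_odd _ #|O|).
set a := ((-1) ^+ #|A|)%R; set b := (_ ^+ odd_perm _)%R.
by case: (odd _); rewrite /= ?expr1 !(mulrN1, mulr1, mulNr, mulrN, opprK).
Qed.

(** The conjugator sends s^i(x) to t^i(x). It is the identity off [D], so that it commutes with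
    every permutation fixing [D] pointwise. *)
Lemma perm_on_cycle_conj D s t x :
    perm_on D s -> perm_on D t -> porbit s x = D -> porbit t x = D ->
  exists2 u, perm_on D u & t = s ^ u.
Proof.
move=> sD tD sx tx; set m := #|D|.
have sm : iter m s x = x by rewrite /m -sx iter_porbit.
have tm : iter m t x = x by rewrite /m -tx iter_porbit.
have us : uniq (traject s x m) by rewrite /m -sx uniq_traject_porbit.
have ut : uniq (traject t x m) by rewrite /m -tx uniq_traject_porbit.
have ms y : (y \in D) = (y \in traject s x m) by rewrite /m -sx porbit_traject.
have Dk i : iter i s x \in D by rewrite -sx -permX mem_porbit.
have Dk' i : iter i t x \in D by rewrite -tx -permX mem_porbit.
pose f y := if y \in D then iter (index y (traject s x m)) t x else y.
have fE i : i < m -> f (iter i s x) = iter i t x.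
  move=> ltim; rewrite /f Dk -[in index _ _](nth_traject s ltim).
  by rewrite index_uniq ?size_traject.
have Dex y : y \in D -> exists2 i, i < m & y = iter i s x.
  rewrite ms => /trajectP[i ltim ->]; by exists i.
have fD y : (f y \in D) = (y \in D)
  by rewrite /f; case: (boolP (y \in D)) => [_|/negPf//]; rewrite Dk'.
have injf : injective f.
  move=> y z eqf; have: (y \in D) = (z \in D) by rewrite -(fD y) -(fD z) eqf.
  case: (boolP (y \in D)) => [Dy /esym Dz|nDy /esym/negbT nDz]; last first.
    by move: eqf; rewrite /f (negPf nDy) (negPf nDz).
  move: eqf; have [[i li ->] [j lj ->]] := (Dex _ Dy, Dex _ Dz).
  rewrite !fE // -(nth_traject t li) -(nth_traject t lj) => /eqP.
  by rewrite nth_uniq ?size_traject // => /eqP ->.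
have fp y : perm injf y = f y by rewrite permE.
exists (perm injf).
  by apply/subsetP => y; rewrite inE fp; apply: contraR => /negPf nD; rewrite /f nD.
rewrite conjgE; apply: (mulgI (perm injf)); rewrite mulKVg.
apply/permP => y; rewrite !permM !fp.
have [Dy|nDy] := boolP (y \in D); last first.
  by rewrite /f (negPf nDy) (out_perm sD nDy) (negPf nDy) (out_perm tD).
have [i li ->] := Dex _ Dy; rewrite fE // -!iterS.
(* At the end of the trajectory both cycles return to [x]. *)
have [/fE//|] := ltnP i.+1 m; rewrite leq_eqVlt ltnNge li orbF => /eqP <-.
by rewrite sm tm -[x in LHS]/(iter 0 t x) -[x in f x]/(iter 0 s x) fE // (leq_trans _ li).
Qed.

End PermutationOrbits.

Import GRing.Theory Num.Theory.

(** * Specht modules *)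

Local Open Scope group_scope.
Local Open Scope ring_scope.

Section RegularSums.
Variable n : nat.
Local Notation G := [group of [set: 'S_n]].
Local Notation rho := (Sn_regular n).
Implicit Types (s t g : 'S_n) (K : {set 'S_n}) (e : 'S_n -> algC).

Lemma Sn_regularM s t : rho (s * t)%g = rho s *m rho t.
Proof. by rewrite repr_mxM ?inE. Qed.

(** Reindex by s -> s t. Below, [t] is a transposition and [c] is 1 or -1. *)
Lemma sum_repr_mulr K e t c :
    (forall s, ((s * t)%g \in K) = (s \in K)) ->
    {in K, forall s, e (s * t)%g = c * e s} ->
  \sum_(s in K) e s *: rho s = c *: ((\sum_(s in K) e s *: rho s) *m rho t).
Proof.
move=> Kt et; rewrite [LHS](reindex_inj (mulIg t)) mulmx_suml scaler_sumr.
apply: eq_big => s; first exact: Kt.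
by rewrite Kt => /et->; rewrite Sn_regularM -scalemxAl scalerA.
Qed.

Lemma sum_repr_mull K e t c :
    (forall s, ((t * s)%g \in K) = (s \in K)) ->
    {in K, forall s, e (t * s)%g = c * e s} ->
  \sum_(s in K) e s *: rho s = c *: (rho t *m (\sum_(s in K) e s *: rho s)).
Proof.
move=> Kt et; rewrite [LHS](reindex_inj (mulgI t)) mulmx_sumr scaler_sumr.
apply: eq_big => s; first exact: Kt.
by rewrite Kt => /et->; rewrite Sn_regularM -scalemxAr scalerA.
Qed.

(** Since g t = (g t g^-1) g, absorbing [t] on the side of [N] and on the side of [M] evaluates the
    same product as -c M (g t) N and as c M (g t) N. *)
Lemma sum_repr_annihilate (M N : 'M[algC]_#|G|) t g c :
    M = c *: (M *m rho (t ^ g^-1)%g) -> N = (- c) *: (rho t *m N) ->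
  M *m rho g *m N = 0.
Proof.
move=> eM eN; have eMN : M *m rho g *m N = - (M *m rho g *m N).
  transitivity (- (c *: (M *m rho (g * t)%g *m N))).
    by rewrite {1}eN -scalemxAr scaleNr Sn_regularM !mulmxA.
  congr (- _); rewrite [in RHS]eM -!scalemxAl -[in RHS](mulmxA _ _ (rho g)).
  by rewrite -Sn_regularM conjgE invgK !mulgA mulgKV.
apply/eqP; have /eqP := eMN.
by rewrite -addr_eq0 -mulr2n -scaler_nat scaler_eq0 pnatr_eq0.
Qed.

Definition sgn_on (A : {set 'I_n}) (s : 'S_n) : algC := (-1) ^+ (restr_perm A s).

(** For A inside D this is Sym A x Sym (D \ A), and its sum weighted by [sgn_on A] is the signed sum
    of Sym A times the sum of Sym (D \ A). *)
Definition Sym_stab (D A : {set 'I_n}) : {set 'S_n} :=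
  perm.Sym D :&: 'N(A | 'P)%act.

End RegularSums.

Lemma partsP n (l : intpart n) : is_partn n (parts l).
Proof. by rewrite /parts; case: l. Qed.

Lemma parts_sorted n (l : intpart n) : sorted geq (parts l).
Proof. by have /and3P[] := partsP l. Qed.

Lemma parts_pos n (l : intpart n) : 0%N \notin parts l.
Proof. by have /and3P[] := partsP l. Qed.

Lemma sumn_parts n (l : intpart n) : sumn (parts l) = n.
Proof. by have /and3P[_ _ /eqP] := partsP l. Qed.

(** * Vanishing of the character on long cycles *)

Section SpechtVanishing.
Variables (n : nat) (l : intpart n).
Local Notation rho := (Sn_regular n).

Lemma tab_row_lt (k : 'I_n) : (tab_row l k < size (parts l))%N.
Proof. by apply: reshape_indexP; rewrite sumn_parts. Qed.

Lemma tab_col_lt (k : 'I_n) : (tab_col l k < head 0 (parts l))%N.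
Proof.
have lt_k : (k < sumn (parts l))%N by rewrite sumn_parts.
apply: leq_trans (reshape_offsetP lt_k) _.
have srt := parts_sorted l; have lr := reshape_indexP lt_k.
case: (parts l) srt lr => //= x s srt lr.
have := order_path_min (rev_trans leq_trans) srt.
by move=> /(all_nthP 0); case: (reshape_index _ _) lr => //= i lr; apply.
Qed.

Lemma tab_inj (j k : 'I_n) :
  tab_row l j = tab_row l k -> tab_col l j = tab_col l k -> j = k.
Proof.
move=> er ec; apply: val_inj => /=.
by rewrite -(reshape_indexK (parts l) j) -(reshape_indexK (parts l) k);
  congr flatten_index.
Qed.

Lemma row_stab_tperm (x y : 'I_n) s : tab_row l x = tab_row l y ->
  ((s * tperm x y)%g \in row_stab l) = (s \in row_stab l).
Proof.
move=> exy; rewrite !inE; apply: eq_forallb => k; rewrite permM.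
by case: tpermP => // ->; rewrite exy.
Qed.

Lemma col_stab_tperm (x y : 'I_n) s : tab_col l x = tab_col l y ->
  ((s * tperm x y)%g \in col_stab l) = (s \in col_stab l).
Proof.
move=> exy; rewrite !inE; apply: eq_forallb => k; rewrite permM.
by case: tpermP => // ->; rewrite exy.
Qed.

Lemma pigeonhole_lt (A : {set 'I_n}) (f : 'I_n -> nat) b :
    (forall k, f k < b)%N -> (b < #|A|)%N ->
  exists x y, [/\ x \in A, y \in A, x != y & f x = f y].
Proof.
case: b => [|b] fb ltb.
  by have /card_gt0P[x _] := ltb; have := fb x.
pose h k : 'I_b.+1 := Ordinal (fb k).
have : ~~ injectiveb [ffun z : {x | x \in A} => h (val z)].
  apply/negP => /injectiveP inj; have := leq_card _ inj.
  by rewrite card_sig card_ord leqNgt ltb.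
case/injectivePn => u [v uv]; rewrite !ffunE => /(congr1 val) /= e.
by exists (val u), (val v); split; rewrite ?(valP u) ?(valP v).
Qed.

(** Two points of [A] whose preimages under [g] share a row, or two points of [D :\: A] whose
    preimages share a column, give a transposition that the two factors absorb with opposite
    signs. *)
Lemma young_symmetrizer_annihilate (D A : {set 'I_n}) g :
    A \subset D -> (head 0 (parts l) + size (parts l) < #|D|)%N ->
  young_symmetrizer l *m rho g *m
    (\sum_(s in Sym_stab D A) sgn_on A s *: rho s) = 0.
Proof.
move=> AD ltD; set X := \sum_(s in _) _.
have tdom (x y : 'I_n) s : x \in D -> y \in D -> (x \in A) = (y \in A) ->
    ((tperm x y * s)%g \in Sym_stab D A) = (s \in Sym_stab D A).
  move=> Dx Dy eA; apply: groupMl; rewrite inE; apply/andP; split.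
    rewrite inE; apply/subsetP => z; rewrite inE; apply: contraR => nz.
    by rewrite tpermD //; apply: contraNneq nz => <-.
  apply/astabsP => z /=; rewrite apermE.
  by case: tpermP => [->|->|].
have rA (x y : 'I_n) s : x != y -> x \in A -> y \in A -> s \in Sym_stab D A ->
    sgn_on A (tperm x y * s)%g = - sgn_on A s.
  move=> xy Ax Ay /setIP[sD sA]; rewrite /sgn_on.
  have tN : tperm x y \in 'N(A | 'P)%act.
    by apply/astabsP => z /=; rewrite apermE; case: tpermP => [->|->|]; rewrite ?Ax ?Ay.
  rewrite morphM //= odd_permM signr_addb.
  suff -> : restr_perm A (tperm x y) = tperm x y by rewrite odd_tperm xy mulN1r.
  apply/permP => z; have [Az|nAz] := boolP (z \in A); first by rewrite restr_permE.
  rewrite (out_perm (restr_perm_on _ _)) // tpermD //; by apply: contraNneq nAz => <-.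
have rnA (x y : 'I_n) s : x \notin A -> y \notin A -> s \in Sym_stab D A ->
    sgn_on A (tperm x y * s)%g = sgn_on A s.
  move=> Ax Ay /setIP[sD sA]; rewrite /sgn_on.
  have tN : tperm x y \in 'N(A | 'P)%act.
    by apply/astabsP => z /=; rewrite apermE; case: tpermP => [->|->|];
      rewrite ?(negPf Ax) ?(negPf Ay).
  rewrite morphM //=.
  suff -> : restr_perm A (tperm x y) = 1%g by rewrite mul1g.
  apply/permP => z; have [Az|nAz] := boolP (z \in A); last first.
    by rewrite (out_perm (restr_perm_on _ _)) // perm1.
  by rewrite restr_permE // perm1 tpermD //; apply: contraTneq Az => <-.
rewrite /young_symmetrizer -!gring_row_mul.
set a := \sum_(s in row_stab l) _; set b := \sum_(s in col_stab l) _.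
suff -> : a *m b *m rho g *m X = 0 by rewrite linear0.
have [ltA|leA] := ltnP (size (parts l)) #|A|.
  (* The signed column sum stands between [a] and [rho g], so [h] is arbitrary: it will be [s * g]
     for each [s] in [col_stab l]. *)
  have kill h : a *m rho h *m X = 0.
    have [x [y [Ax Ay xy exy]]] :=
      pigeonhole_lt (fun k => tab_row_lt (h^-1%g k)) ltA.
    have aE : a = \sum_(s in row_stab l) 1 *: rho s.
      by apply: eq_bigr => s _; rewrite scale1r.
    apply: (@sum_repr_annihilate n a X (tperm x y) h 1).
      rewrite aE; apply: sum_repr_mulr => [s|s _]; rewrite ?mulr1 //.
      by rewrite tpermJ row_stab_tperm.
    apply: sum_repr_mull => [s|s sd].
      by rewrite tdom ?(subsetP AD) ?Ax ?Ay.
    by rewrite rA // mulN1r.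
  move: a X kill {rA rnA} => a X kill.
  rewrite -!mulmxA /b mulmx_suml mulmx_sumr big1 // => s _.
  rewrite -scalemxAl -scalemxAr (mulmxA (rho s)) -Sn_regularM mulmxA.
  by rewrite kill scaler0.
have ltB : (head 0 (parts l) < #|D :\: A|)%N.
  have := cardsID A D; rewrite (setIidPr AD) => eD.
  rewrite -(ltn_add2r #|A|) [in X in (_ < X)%N]addnC eD.
  by apply: leq_ltn_trans ltD; rewrite leq_add2l.
have [x [y [Bx By xy exy]]] :=
  pigeonhole_lt (fun k => tab_col_lt (g^-1%g k)) ltB.
have /setDP[Dx nAx] := Bx; have /setDP[Dy nAy] := By.
suff kill : b *m rho g *m X = 0 by rewrite -!mulmxA (mulmxA b) kill mulmx0.
apply: (@sum_repr_annihilate n b X (tperm x y) g (-1)).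
  apply: sum_repr_mulr => [s|s _]; rewrite tpermJ ?col_stab_tperm //.
  by rewrite odd_permM signr_addb odd_tperm (inj_eq perm_inj) xy mulrN1 mulN1r.
rewrite opprK; apply: sum_repr_mull => [s|s sd].
  by rewrite tdom // (negPf nAx) (negPf nAy).
by rewrite rnA // mul1r.
Qed.

(** The module is spanned by the translates of its generator, so it suffices to kill these. *)
Lemma specht_sum_eq0 (K : {set 'S_n}) (e : 'S_n -> algC) :
    (forall g, young_symmetrizer l *m rho g *m (\sum_(s in K) e s *: rho s) = 0) ->
  \sum_(s in K) e s *: specht_repr l s = 0.
Proof.
move=> kill; set X := \sum_(s in K) e s *: rho s.
pose V := cyclic_mx rho (young_symmetrizer l).
have VX : val_submod (1%:M : 'M_(\rank V)) *m X = 0.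
  apply/row_matrixP => i; rewrite row0 row_mul.
  have /cyclic_mxP[B /envelop_mxP[c ->] ->] :
      (row i (val_submod (1%:M : 'M_(\rank V))) <= V)%MS.
    by apply: submx_trans (row_sub _ _) _; rewrite val_submodP.
  rewrite -mulmxA mulmx_suml mulmx_sumr big1 // => s _.
  by rewrite -scalemxAl -scalemxAr mulmxA kill scaler0.
transitivity (in_submod V (val_submod (1%:M : 'M_(\rank V)) *m X)); last first.
  by rewrite VX linear0.
by rewrite /X mulmx_sumr linear_sum; apply: eq_bigr => s _; rewrite -scalemxAr linearZ.
Qed.

(** Write g = c h with c the cycle of g on D. The alternating sum of the annihilators over A is the
    sum of all D-cycles; after multiplication by h each of its terms is conjugate to g, so its
    trace, which is 0, is a positive multiple of the value at g. *)
Lemma specht_char_cycle_eq0 (g : 'S_n) x :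
    (head 0 (parts l) + size (parts l) < #|porbit g x|)%N ->
  specht_char l g = 0.
Proof.
set D := porbit g x => ltD; set W := specht_repr l.
have gD : g \in 'N(D | 'P)%act by apply: porbit_stab.
set c := restr_perm D g; set h := (c^-1 * g)%g.
have cD : perm_on D c by apply: restr_perm_on.
have cx : porbit c x = D.
  suff cX i : (c ^+ i)%g x = (g ^+ i)%g x.
    by apply/setP => y; apply/porbitP/porbitP => -[i ->]; exists i => //; rewrite cX.
  elim: i => [|i IH]; first by rewrite !perm1.
  by rewrite !expgSr !permM IH restr_permE // mem_porbit.
have hD y : y \in D -> h y = y.
  move=> Dy; rewrite /h permM.
  have Dc : c^-1%g y \in D.
    by rewrite -(perm_closed _ cD) permKV.
  by rewrite -[g _](restr_permE gD Dc) -/c permKV.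
have trE s : \tr (W s) = specht_char l s by rewrite cfunE in_setT mulr1n.
have Dx : x \in D by apply: porbit_id.
have sum0 : \sum_(A in powerset (D :\ x)) (-1) ^+ #|A| *:
    \sum_(s in Sym_stab D A) sgn_on A s *: W s = 0.
  apply: big1 => A; rewrite powersetE => AD.
  rewrite specht_sum_eq0 ?scaler0 // => t; apply: young_symmetrizer_annihilate => //.
  by apply: subset_trans AD (subsetDl _ _).
have sum1 : \sum_(s in perm.Sym D) (porbit s x == D)%:R *: W s = 0.
  rewrite -{}[RHS]sum0.
  under [RHS]eq_bigr => A _ do rewrite scaler_sumr.
  rewrite (exchange_big_dep (mem (perm.Sym D))) /= => [|A s _ /setIP[]//].
  apply: eq_bigr => s; rewrite inE => sD.
  rewrite -(@sum_sign_stab _ algC D x s) // scaler_suml.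
  apply: eq_big => [A|A _]; last by rewrite scalerA.
  by rewrite !inE sD.
(* This gives (c ^ u) h = (c h) ^ u = g ^ u below. *)
have commh u : perm_on D u -> (u * h = h * u)%g; first clearbody h.
  move=> uD; apply/permP => y; rewrite !permM.
  have [Dy|nDy] := boolP (y \in D); first by rewrite !hD ?perm_closed.
  rewrite (out_perm uD nDy) (out_perm uD) //.
  apply: contra nDy => Dhy; have := hD _ Dhy.
  by move/perm_inj => <-.
have {}sum1 : \sum_(s in perm.Sym D) (porbit s x == D)%:R * specht_char l g = 0.
  have: \tr ((\sum_(s in perm.Sym D) (porbit s x == D)%:R *: W s) *m W h) = 0.
    by rewrite sum1 mul0mx mxtrace0.
  rewrite mulmx_suml raddf_sum /= => {2}<-; apply: eq_bigr => s.
  rewrite inE => sD; case: eqP => [sx|_];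
    last by rewrite !(scale0r, mul0mx, mxtrace0, mul0r).
  rewrite scale1r mul1r -repr_mxM ?in_setT // trE.
  have [u uD ->] := perm_on_cycle_conj cD sD cx sx.
  have -> : ((c ^ u) * h = g ^ u)%g.
    rewrite !conjgE -!mulgA commh // -[in RHS](mulKVg c g) -/h.
    by rewrite !mulgA.
  by rewrite cfunJ ?in_setT.
move: sum1; rewrite -mulr_suml => /eqP; rewrite mulf_eq0 => /orP[|/eqP//].
(* [c] itself is a [D]-cycle, so their number is not 0. *)
rewrite -natr_sum pnatr_eq0 (bigD1 c) ?inE //= cx eqxx.
by [].
Qed.

Lemma gring_row_Sn s :
  gring_row (rho s) 0 (gring_index [group of [set: 'S_n]] 1%g) = (s == 1%g)%:R.
Proof.
rewrite /gring_row rowK gring_indexK ?group1 // mul1g mxE eqxx /=.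
by rewrite (can_in_eq (@gring_indexK _ _)) ?in_setT // eq_sym.
Qed.

(* The coefficient at 1 is 1, because only the identity preserves both the rows
   and the columns of the tableau. *)
Lemma young_symmetrizer_neq0 : young_symmetrizer l != 0.
Proof.
apply/eqP => /matrixP/(_ 0 (gring_index [group of [set: 'S_n]] 1%g)) /eqP.
rewrite [in X in _ == X]mxE; apply/negP.
rewrite /young_symmetrizer mulmx_suml linear_sum summxE (bigD1 1%g) /=; last first.
  by rewrite inE; apply/forallP => k; rewrite perm1.
rewrite mulmx_sumr linear_sum summxE (bigD1 1%g) /=; last first.
  by rewrite inE; apply/forallP => k; rewrite perm1.
rewrite -scalemxAr linearZ /= odd_perm1 scale1r -Sn_regularM gring_row_Sn mulg1 eqxx.
rewrite [X in _ + X]big1 => [|r]; first rewrite addr0 big1 ?addr0 ?oner_eq0 //.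
  move=> c /andP[_ /negPf c1].
  by rewrite -scalemxAr linearZ /= mxE -Sn_regularM gring_row_Sn mul1g c1 mulr0.
move=> /andP[]; rewrite inE => /forallP rP r1.
rewrite mulmx_sumr linear_sum summxE big1 // => c; rewrite inE => /forallP cP.
rewrite -scalemxAr linearZ /= mxE -Sn_regularM gring_row_Sn.
case: eqP => [rc|_]; last by rewrite mulr0.
case/eqP: r1; apply/permP => k; rewrite perm1; apply: tab_inj; first exact/eqP.
by rewrite -(eqP (cP (r k))) -permM rc perm1.
Qed.

Lemma char_degreeE : (char_degree l)%:R = specht_char l 1%g.
Proof. by rewrite /char_degree /specht_char cfRepr1 Num.Theory.natrK. Qed.

(** As [logn q 0] is 0, divisibility bounds the valuation from below only for a nonzero degree. *)
Lemma char_degree_gt0 : (0 < char_degree l)%N.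
Proof.
rewrite /char_degree /specht_char cfRepr1 Num.Theory.natrK lt0n mxrank_eq0.
by rewrite cyclic_mx_eq0 young_symmetrizer_neq0.
Qed.

End SpechtVanishing.

(* Every linear character of H extends to G, and by the vanishing hypothesis its
   multiplicity in phi is #|G : H| times that of the extension. *)
Lemma char1_index_dvd (gT : finGroupType) (G H : {group gT}) (phi : 'CF(G)) :
    abelian G -> H \subset G -> phi \is a character ->
    {in G :\: H, forall x, phi x = 0} ->
  exists m : nat, phi 1%g = (#|G : H| * m)%:R.
Proof.
move=> abG sHG Nphi phi0.
have abH := abelianS sHG abG.
have lift i : exists j, '['Res[H] phi, 'chi_i] = #|G : H|%:R * '[phi, 'chi[G]_j].
  have [j] := constt_cfInd_irr i sHG; rewrite constt_Ind_Res => ij; exists j.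
  have linj : 'chi_j \is a linear_char by apply/char_abelianP.
  (* The restriction of ['chi_j] is irreducible and contains ['chi_i], so it equals it. *)
  have /irrP[k Rk] := lin_char_irr (cfRes_lin_char H linj).
  move: ij; rewrite Rk constt_irr => /eqP ik; rewrite ik -Rk {ik Rk}.
  (* Only [H] contributes to the product over [G]; comparing the factors 1 / #|G| and 1 / #|H|
     produces the index. *)
  rewrite !cfdotE [in RHS](big_setID H) /= (setIidPr sHG) [X in _ + X]big1; last first.
    by move=> x /phi0->; rewrite mul0r.
  rewrite addr0 mulrA; congr (_ * _).
    rewrite -(Lagrange sHG) natrM invfM mulrCA mulfV ?mulr1 //.
    by rewrite pnatr_eq0 -lt0n indexg_gt0.
  by apply: eq_bigr => x Hx; rewrite !cfResE.
have mult i : exists m : nat, '['Res[H] phi, 'chi_i] = (#|G : H| * m)%:R.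
  have [j ->] := lift i; have /natrP[m ->] := Cnat_cfdot_char_irr j Nphi.
  by exists m; rewrite natrM.
have [c cE] := fin_all_exists mult.
(* [H] is abelian, so the degree is the sum of the multiplicities. *)
exists (\sum_i c i)%N; rewrite -(cfRes1 H) [in LHS](cfun_sum_cfdot ('Res[H] phi)).
rewrite sum_cfunE big_distrr natr_sum /=; apply: eq_bigr => i _.
by rewrite cfunE cE lin_char1 ?mulr1 //; apply/char_abelianP.
Qed.

(** * Rotations of disjoint blocks *)

Section BlockRotation.
Variables (n Q k : nat).
Hypotheses (Q_gt0 : (0 < Q)%N) (kQ_le_n : (k * Q <= n)%N).

(** Exponents are natural numbers read modulo [Q], so that composing rotations adds them. *)
Definition rot_fun (e : nat -> nat) (x : nat) : nat :=
  if (x < k * Q)%N then (x %/ Q * Q + (x %% Q + e (x %/ Q)) %% Q)%N else x.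

Lemma rot_fun_blk e b y : (b < k)%N -> (y < Q)%N ->
  rot_fun e (b * Q + y) = (b * Q + (y + e b) %% Q)%N.
Proof.
move=> bk yQ; rewrite /rot_fun divnMDl // divn_small // addn0 modnMDl (modn_small yQ).
suff -> : (b * Q + y < k * Q)%N by [].
apply: (@leq_trans (b.+1 * Q)); last by rewrite leq_mul2r bk orbT.
by rewrite mulSn addnC ltn_add2r.
Qed.

Lemma rot_fun_out e x : (k * Q <= x)%N -> rot_fun e x = x.
Proof. by rewrite /rot_fun ltnNge => ->. Qed.

Lemma blkP x : (x < k * Q)%N ->
  exists b y, [/\ (b < k)%N, (y < Q)%N & x = (b * Q + y)%N].
Proof.
move=> lx; exists (x %/ Q)%N, (x %% Q)%N; split; last exact: divn_eq.
  by rewrite ltn_divLR.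
by rewrite ltn_mod.
Qed.

Lemma rot_funD e f x : rot_fun f (rot_fun e x) = rot_fun (fun b => e b + f b)%N x.
Proof.
have [|/blkP[b [y [bk yQ ->]]]] := leqP (k * Q) x.
  by move=> ?; rewrite !rot_fun_out.
by rewrite !rot_fun_blk ?ltn_mod // modnDml /= addnA.
Qed.

Lemma rot_fun0 e x : (forall b, (Q %| e b)%N) -> rot_fun e x = x.
Proof.
move=> e0; have [|/blkP[b [y [bk yQ ->]]]] := leqP (k * Q) x; first exact: rot_fun_out.
by rewrite rot_fun_blk // -modnDmr (eqP (e0 b)) addn0 modn_small.
Qed.

Lemma rot_fun_lt e (x : 'I_n) : (rot_fun e x < n)%N.
Proof.
have [|/blkP[b [y [bk yQ ->]]]] := leqP (k * Q) x; first by move/rot_fun_out->.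
rewrite rot_fun_blk //; apply: leq_trans kQ_le_n.
apply: (@leq_trans (b.+1 * Q)); last by rewrite leq_mul2r bk orbT.
by rewrite mulSn addnC ltn_add2r ltn_mod.
Qed.

Definition rot_ord e (x : 'I_n) : 'I_n := Ordinal (rot_fun_lt e x).

Lemma rot_ord_inj e : injective (rot_ord e).
Proof.
(* [Q.-1 * e b] stands for the opposite of [e b] modulo [Q]. *)
apply: (@can_inj _ _ _ (rot_ord (fun b => Q.-1 * e b)%N)) => x; apply: val_inj => /=.
rewrite rot_funD rot_fun0 // => b.
by rewrite -mulSn prednK // dvdn_mulr.
Qed.

Definition rot_perm e : 'S_n := perm (@rot_ord_inj e).

Lemma rot_permE e x : val (rot_perm e x) = rot_fun e x.
Proof. by rewrite permE. Qed.

Lemma rot_permM e f : (rot_perm e * rot_perm f)%g = rot_perm (fun b => e b + f b)%N.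
Proof. by apply/permP => x; apply: val_inj; rewrite permM !rot_permE rot_funD. Qed.

Lemma rot_permX e i : (rot_perm e ^+ i)%g = rot_perm (fun b => i * e b)%N.
Proof.
elim: i => [|i IH].
  by apply/permP => x; apply: val_inj; rewrite perm1 rot_permE rot_fun0.
rewrite expgS IH rot_permM; apply/permP => x; apply: val_inj.
by rewrite !rot_permE /rot_fun.
Qed.

(* The exponents are the multiples of d modulo Q: d = 1 gives all block
   rotations. *)
Definition rot_set d : {set 'S_n} :=
  [set rot_perm (fun b => d * oapp (fun i => val (f i)) 0%N (insub b))%N
    | f : {ffun 'I_k -> 'I_(Q %/ d)}].

Lemma eq_rot_perm e f : (forall b, (b < k)%N -> e b = f b %[mod Q]) ->
  rot_perm e = rot_perm f.
Proof.
move=> ef; apply/permP => x; apply: val_inj; rewrite !rot_permE.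
have [|/blkP[b [y [bk yQ ->]]]] := leqP (k * Q) x; first by move=> ?; rewrite !rot_fun_out.
by rewrite !rot_fun_blk // -modnDmr ef // modnDmr.
Qed.

Lemma mem_rot_set d e : (d %| Q)%N -> (forall b, (b < k)%N -> (d %| e b)%N) ->
  rot_perm e \in rot_set d.
Proof.
move=> dQ de; have Qd_gt0 : (0 < Q %/ d)%N by rewrite divn_gt0 ?(dvdn_gt0 _ dQ) // dvdn_leq.
apply/imsetP.
(* Reducing e / d modulo Q / d changes e by a multiple of Q. *)
exists [ffun i : 'I_k => Ordinal (ltn_pmod (e i %/ d) Qd_gt0)] => //.
apply: eq_rot_perm => b bk; rewrite insubT /= ffunE /=.
by rewrite muln_modr -[(d * (Q %/ d))%N]mulnC divnK // modn_mod mulnC divnK ?de.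
Qed.

Lemma rot_setP d s : s \in rot_set d ->
  exists2 e, s = rot_perm e & forall b, (d %| e b)%N.
Proof.
by case/imsetP=> f _ ->; eexists; first by []; move=> b; rewrite dvdn_mulr.
Qed.

Lemma rot_group_set d : (d %| Q)%N -> group_set (rot_set d).
Proof.
move=> dQ; apply/group_setP; split=> [|s t /rot_setP[e -> de] /rot_setP[f -> df]].
  suff -> : 1%g = rot_perm (fun=> 0%N) by apply: mem_rot_set.
  by apply/permP => x; apply: val_inj; rewrite perm1 rot_permE rot_fun0.
by rewrite rot_permM; apply: mem_rot_set => // b _; rewrite dvdn_addl.
Qed.

Lemma card_rot_set d : (d %| Q)%N -> #|rot_set d| = ((Q %/ d) ^ k)%N.
Proof.
move=> dQ; rewrite card_imset ?card_ffun ?card_ord // => f g efg.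
apply/ffunP => b; apply: val_inj.
have d_gt0 := dvdn_gt0 Q_gt0 dQ.
(* The first point of block [b] moves by [d * f b], which is below [Q] and so determines [f b]. *)
have bQn : (b * Q < n)%N.
  by apply: leq_trans kQ_le_n; rewrite ltn_mul2r Q_gt0 ltn_ord.
have := congr1 (fun s : 'S_n => val (s (Ordinal bQn))) efg.
rewrite !rot_permE /= -[(b * Q)%N]addn0 !rot_fun_blk // => /addnI.
have small (h : {ffun 'I_k -> 'I_(Q %/ d)}) : (d * h b < Q)%N.
  by rewrite -[X in (_ < X)%N](divnK dQ) mulnC ltn_mul2r d_gt0 ltn_ord.
rewrite !add0n /= !valK /= !modn_small ?small // => /eqP.
by rewrite eqn_pmul2l // => /eqP.
Qed.

(** The multiples i * e b for i < Q are distinct modulo [Q], so the first point of block [b] has [Q]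
    distinct images. *)
Lemma rot_porbit e b : (b < k)%N -> coprime (e b) Q ->
  exists x, (Q <= #|porbit (rot_perm e) x|)%N.
Proof.
move=> bk co.
have bQn : (b * Q < n)%N.
  by apply: leq_trans kQ_le_n; rewrite ltn_mul2r Q_gt0.
exists (Ordinal bQn); set x := Ordinal bQn.
rewrite -[X in (X <= _)%N]card_ord.
have inj : injective (fun i : 'I_Q => (rot_perm e ^+ i)%g x).
  move=> i j /(congr1 val); rewrite !rot_permX !rot_permE /= -[(b * Q)%N]addn0.
  rewrite !rot_fun_blk // => /addnI; rewrite !add0n => /eqP.
  have key (u v : 'I_Q) : (u <= v)%N -> (u * e b == v * e b %[mod Q])%N -> u = v.
    move=> uv; rewrite eq_sym eqn_mod_dvd ?leq_mul2r ?uv ?orbT // -mulnBl.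
    rewrite Gauss_dvdl 1?coprime_sym // => dv; apply: val_inj => /=.
    apply/eqP; rewrite eqn_leq uv /= -subn_eq0.
    have := ltn_ord v; case: (posnP (v - u)) => [_ //|p].
    by rewrite ltnNge (leq_trans (dvdn_leq p dv)) ?leq_subr.
  by case/orP: (leq_total i j) => ij; [|move=> ji; apply/esym; rewrite eq_sym in ji];
    [exact: key | exact: key ji].
rewrite -(card_imset _ inj); apply/subset_leq_card/subsetP => y /imsetP[i _ ->].
exact: mem_porbit.
Qed.

End BlockRotation.

(* Restrict to the group of block rotations by multiples of 1; outside the
   subgroup of rotations by multiples of q some block is a full Q-cycle. *)
Lemma char_degree_dvd n (l : intpart n) q i :
    prime q -> (head 0 (parts l) + size (parts l) < q ^ i.+1)%N ->
  (q ^ (n %/ q ^ i.+1) %| char_degree l)%N.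
Proof.
move=> pq ltQ; set Q := (q ^ i.+1)%N; set k := (n %/ Q)%N.
have Q0 : (0 < Q)%N by rewrite expn_gt0 prime_gt0.
have kQ : (k * Q <= n)%N by apply: leq_trunc_div.
have qQ : (q %| Q)%N by rewrite dvdn_exp.
pose P := Group (rot_group_set Q0 kQ (dvd1n Q)).
pose H := Group (rot_group_set Q0 kQ qQ).
have PP s : s \in P -> exists e, s = rot_perm Q0 kQ e.
  by case/rot_setP=> e -> _; exists e.
have sHP : H \subset P.
  by apply/subsetP => s /rot_setP[e -> _]; apply: mem_rot_set => // b _; apply: dvd1n.
have abP : abelian P.
  apply/centsP => s /PP[e ->] t /PP[f ->]; rewrite /commute !rot_permM.
  by apply: eq_rot_perm => b _; rewrite addnC.
have idx : #|P : H| = (q ^ k)%N.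
  rewrite -divgS // !card_rot_set // divn1 -[X in (X ^ k %/ _)%N](divnK qQ) expnMn.
  by rewrite mulKn // expn_gt0 divn_gt0 ?prime_gt0 // dvdn_leq.
have [] := @char1_index_dvd _ P H ('Res[P] (specht_char l)) abP sHP.
- exact/cfRes_char/cfRepr_char.
- move=> s /setDP[Ps nHs]; rewrite cfResE ?subsetT //.
  have [e es] := PP _ Ps.
  (* Off [H] some exponent is prime to [q], hence to [Q], and its block is a cycle too long for the
     character. *)
  have [b /andP[bk qe]] : exists b, (b < k)%N && ~~ (q %| e b)%N.
    have [/existsP[b ?]|/existsPn all] := boolP [exists b : 'I_k, ~~ (q %| e b)%N].
      by exists b; rewrite ltn_ord.
    case/negP: nHs; rewrite es; apply: mem_rot_set => // b bk.
    by have := all (Ordinal bk); rewrite negbK.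
  have [|x ltx] := rot_porbit Q0 kQ bk (e := e).
    by rewrite coprime_sym coprimeXl // prime_coprime.
  by rewrite es (@specht_char_cycle_eq0 _ _ _ x) // (leq_trans ltQ).
move=> m; rewrite cfRes1 -char_degreeE idx => /eqP; rewrite eqr_nat => /eqP ->.
exact: dvdn_mulr.
Qed.

(** * Counting partitions *)

Local Open Scope nat_scope.

Section Partitions.
Implicit Types (n N M L : nat) (s u : seq nat).

Lemma parts_inj n : injective (@parts n).
Proof.
move=> l l' /(inj_map val_inj) e; apply: val_inj; exact: val_inj.
Qed.

Lemma perm_parts n (l l' : intpart n) : perm_eq (parts l) (parts l') -> l = l'.
Proof.
move=> e; apply/parts_inj/(sorted_eq _ _ (parts_sorted l) (parts_sorted l') e).
- by move=> y x z; rewrite /geq => xy yz; apply: leq_trans xy.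
- by move=> x y; rewrite /geq /= andbC => /anti_leq.
Qed.

Lemma leq_size_sumn s : 0 \notin s -> size s <= sumn s.
Proof. by elim: s => //= x s IH; rewrite inE negb_or => /andP[x0 /IH]; lia. Qed.

Lemma leq_mem_sumn s x : x \in s -> x <= sumn s.
Proof. by elim: s => //= y s IH; rewrite inE => /orP[/eqP->|/IH]; lia. Qed.

Lemma intpart_of_seq n s :
  0 \notin s -> sumn s = n -> exists l : intpart n, perm_eq (parts l) s.
Proof.
move=> s0 sn; pose t := sort geq s.
have pts : perm_eq t s by rewrite perm_sort.
have sz : size (map (@inord n) t) <= n.
  by rewrite size_map (perm_size pts) -sn leq_size_sumn.
have tE : map val (map (@inord n) t) = t.
  rewrite -map_comp -[RHS]map_id; apply/eq_in_map => x /= xt.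
  by rewrite inordK // ltnS -sn leq_mem_sumn // -(perm_mem pts).
have pt : is_partn n (map val (Bseq sz : n.-bseq 'I_n.+1)).
  rewrite /= tE /is_partn (perm_mem pts) s0 (perm_sumn pts) sn eqxx andbT andbT.
  by apply: sort_sorted => x y; apply: leq_total.
by exists (exist _ (Bseq sz) pt); rewrite /parts /= tE.
Qed.

(** Injectivity is cancellation of the multiset [u]; working up to permutation avoids describing
    sorted insertion. *)
Lemma intpart_add n u : 0 \notin u ->
  exists2 f : intpart n -> intpart (n + sumn u), injective f &
    forall l, perm_eq (parts (f l)) (u ++ parts l).
Proof.
move=> u0; have ex (l : intpart n) :
    exists l' : intpart (n + sumn u), perm_eq (parts l') (u ++ parts l).
  apply: intpart_of_seq; first by rewrite mem_cat negb_or u0 parts_pos.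
  by rewrite sumn_cat sumn_parts addnC.
have [f fE] := fin_all_exists ex; exists f => // l l' e; apply: perm_parts.
rewrite -(perm_cat2l u); apply: perm_trans (fE l'); rewrite -e perm_sym.
exact: fE.
Qed.

Lemma leq_card_intpart n N : n <= N -> #|intpart n| <= #|intpart N|.
Proof.
move=> le_nN; have u0 : 0 \notin nseq (N - n) 1 by rewrite mem_nseq andbF.
have [f inj _] := @intpart_add n _ u0; have := leq_card f inj.
by rewrite sumn_nseq mul1n subnKC.
Qed.

Lemma sum_mul_count L s : \sum_(a < L) a.+1 * count_mem a.+1 s <= sumn s.
Proof.
elim: s => [|x s IH] /=; first by rewrite big1 // => a _; rewrite muln0.
under eq_bigr => a _ do rewrite mulnDr.
rewrite big_split /= leq_add //.
case: x => [|x]; first by rewrite big1 // => a _; rewrite muln0.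
have [xL|Lx] := ltnP x L.
  rewrite (bigD1 (Ordinal xL)) //= eqxx muln1 big1 ?addn0 // => a /eqP ax.
  by case: eqP => [[xa]|]; rewrite ?muln0 //; case: ax; apply: val_inj.
by rewrite big1 // => a _; case: eqP => [[xa]|]; rewrite ?muln0 //; move: Lx;
  rewrite xa leqNgt ltn_ord.
Qed.

(* For each a <= L, adding floor(L / a) parts a and (L mod a) parts 1 is an
   injection; a partition of N = n + L is in the image for at most 2N/L values of
   a, because each of them accounts for parts of total size at least L / 2. *)
Lemma card_intpart_growth n L :
  #|intpart n| * L ^ 2 <= 2 * (n + L) * #|intpart (n + L)|.
Proof.
pose I a := [set l : intpart (n + L) | L %/ a <= count_mem a (parts l)].
have cardI (a : 'I_L) : #|intpart n| <= #|I a.+1|.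
  pose u := nseq (L %/ a.+1) a.+1 ++ nseq (L %% a.+1) 1.
  have u0 : 0 \notin u by rewrite mem_cat !mem_nseq !andbF.
  have un : sumn u = L by rewrite sumn_cat !sumn_nseq mul1n mulnC -divn_eq.
  have [f inj fE] := @intpart_add n _ u0; rewrite un in f inj fE.
  rewrite -cardsT -(card_imset _ inj); apply/subset_leq_card/subsetP => _ /imsetP[l _ ->].
  rewrite inE (seq.permP (fE l)) !count_cat count_nseq /= eqxx mul1n -addnA.
  exact: leq_addr.
have lower : #|intpart n| * L <= \sum_(a < L) #|I a.+1|.
  by rewrite mulnC -[X in X * _ <= _]card_ord -sum_nat_const leq_sum.
rewrite expnS expn1 mulnA.
apply: (@leq_trans ((\sum_(a < L) #|I a.+1|) * L)); first by rewrite leq_mul2r lower orbT.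
under eq_bigr => a _ do rewrite -sum1_card big_mkcond /=.
rewrite exchange_big /= big_distrl /= mulnC -sum_nat_const.
apply: leq_sum => l _; rewrite big_distrl /=.
apply: (@leq_trans (\sum_(a < L) 2 * (a.+1 * count_mem a.+1 (parts l)))).
  apply: leq_sum => a _; rewrite inE; case: ifP => [le_c|_]; rewrite ?mul0n // mul1n.
  apply: (@leq_trans (2 * (a.+1 * (L %/ a.+1)))); last by rewrite !leq_mul2l le_c !orbT.
  (* The quotient is at least 1, so the remainder is smaller than the quotient times [a.+1]. *)
  have := divn_eq L a.+1; have := ltn_pmod L (ltn0Sn a).
  have : 0 < L %/ a.+1 by rewrite divn_gt0 ?ltn_ord.
  by nia.
by rewrite -big_distrr /= leq_mul2l -{2}(sumn_parts l) sum_mul_count orbT.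
Qed.

(** [w] is the size of a piece removed from the partition and [g] is what remains. Putting back
    [w - M] parts 1 gives a partition of [N - M]; together with [w], which takes at most [N.+1]
    values, it determines the original. *)
Lemma card_intpart_weight N M (w : intpart N -> nat) (g : intpart N -> seq nat) :
    (forall l, 0 \notin g l) -> (forall l, sumn (g l) + w l = N) ->
    (forall l l', w l = w l' -> perm_eq (g l) (g l') -> l = l') ->
  #|[pred l | M <= w l]| <= N.+1 * #|intpart (N - M)|.
Proof.
move=> g0 gw inj; have wN l : w l < N.+1 by rewrite -(gw l) ltnS leq_addl.
have ex l : exists l' : intpart (N - M), M <= w l ->
    perm_eq (parts l') (nseq (w l - M) 1 ++ g l).
  have [Mw|] := leqP M (w l); last first.
    (* A default value for [w l < M], where injectivity is not claimed. *)
    have [||l' _] := @intpart_of_seq (N - M) (nseq (N - M) 1); last by exists l'.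
      by rewrite mem_nseq andbF.
    by rewrite sumn_nseq mul1n.
  have [||l' ?] := @intpart_of_seq (N - M) (nseq (w l - M) 1 ++ g l); last by exists l'.
    by rewrite mem_cat negb_or g0 mem_nseq andbF.
  by rewrite sumn_cat sumn_nseq mul1n -(gw l); lia.
have [f fE] := fin_all_exists ex.
pose F l := (Ordinal (wN l), f l).
have injF : {in [pred l | M <= w l] &, injective F}.
  move=> l l'; rewrite !inE => Ml Ml' [ew ef]; apply: inj => //.
  rewrite -(perm_cat2l (nseq (w l - M) 1)) {2}ew.
  apply: perm_trans (fE _ Ml'); rewrite -ef perm_sym; exact: fE.
rewrite -(card_in_image injF); apply: leq_trans (max_card _) _.
by rewrite card_prod card_ord.
Qed.

(** The piece removed is the first row. *)
Lemma card_head_ge N M :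
  #|[pred l : intpart N | M <= head 0 (parts l)]| <= N.+1 * #|intpart (N - M)|.
Proof.
apply: (@card_intpart_weight N M _ (fun l => behead (parts l))) => [l|l|l l' ew pg].
- by apply: contra (parts_pos l); exact: mem_behead.
- by rewrite -[RHS](sumn_parts l); case: (parts l) => //= x s; rewrite addnC.
apply: perm_parts; move: ew pg (parts_pos l) (parts_pos l').
case: (parts l) (parts l') => [|x s] [|y t] //= e; rewrite ?inE.
- by rewrite -e.
- by rewrite e.
by rewrite e perm_cons.
Qed.

(** The piece removed is the first column: each part drops by one and zeros are discarded. Their
    number is recovered from the old and new numbers of parts. *)
Lemma card_size_ge N M :
  #|[pred l : intpart N | M <= size (parts l)]| <= N.+1 * #|intpart (N - M)|.
Proof.
pose g s := filter (predC1 0) (map predn s).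
have gE s : perm_eq (map predn s) (nseq (size s - size (g s)) 0 ++ g s).
  rewrite perm_sym perm_catC.
  have /permPl split_s := perm_filterC (predC1 0) (map predn s).
  apply: perm_trans split_s; rewrite perm_cat2l.
  have /all_pred1P : all (pred1 0) [seq x <- map predn s | predC (predC1 0) x].
    by apply/allP => x; rewrite mem_filter /= negbK => /andP[].
  move=> ->; rewrite perm_sym (_ : size _ = size s - size (g s)) //.
  rewrite -[size s in RHS](size_map predn) size_filter /g size_filter.
  by rewrite -(count_predC (predC1 0) (map predn s)) addKn.
have gK s : 0 \notin s -> map succn (map predn s) = s.
  move=> s0; rewrite -map_comp -[RHS]map_id; apply/eq_in_map => x xs /=.
  by rewrite prednK // lt0n; apply: contraNneq s0 => <-.
apply: (@card_intpart_weight N M _ (fun l => g (parts l))) => [l|l|l l' ew pg].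
- by rewrite mem_filter.
- have -> : sumn (g (parts l)) = sumn (map predn (parts l)).
    by rewrite [in RHS](perm_sumn (gE _)) sumn_cat sumn_nseq mul0n.
  rewrite -[RHS](sumn_parts l); move: (parts_pos l).
  elim: (parts l) => //= x s IH; rewrite inE negb_or => /andP[x0 /IH].
  by case: x x0 => // x _; lia.
apply: perm_parts; rewrite -(gK _ (parts_pos l)) -(gK _ (parts_pos l')).
apply: perm_map; apply: perm_trans (gE _) _; rewrite perm_sym.
apply: perm_trans (gE _) _; rewrite -ew -(perm_size pg) perm_cat2l perm_sym.
exact: pg.
Qed.

(** Removal costs 2 (N + 1) <= 4 N, and each growth step, from N - 2 L to N - L and from there to N,
    costs 2 N / L^2. *)
Lemma card_large_parts N M L : 0 < N -> 2 * L <= M -> M <= N ->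
  #|[pred l : intpart N | (M <= head 0 (parts l)) || (M <= size (parts l))]| * L ^ 4
    <= 16 * N ^ 3 * #|intpart N|.
Proof.
move=> N0 LM MN.
have bad : #|[pred l : intpart N | (M <= head 0 (parts l)) || (M <= size (parts l))]|
    <= 2 * (N.+1 * #|intpart (N - M)|).
  rewrite -cardsE (_ : [set x in _] =
    [set l | M <= head 0 (parts l)] :|: [set l | M <= size (parts l)]).
    apply: leq_trans (leq_card_setU _ _) _; rewrite mul2n -addnn !cardsE.
    by rewrite leq_add ?card_head_ge ?card_size_ge.
  by apply/setP => l; rewrite !inE.
have g1 := card_intpart_growth (N - 2 * L) L.
have g2 := card_intpart_growth (N - L) L.
have e1 : N - 2 * L + L = N - L by lia.
have e2 : N - L + L = N by lia.
rewrite e1 in g1; rewrite e2 in g2.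
have mono : #|intpart (N - M)| <= #|intpart (N - 2 * L)| by apply: leq_card_intpart; lia.
set B := #|[pred l | _]| in bad *; move: bad g1 g2 mono.
move: B (#|intpart (N - M)|) (#|intpart (N - 2 * L)|) (#|intpart (N - L)|) (#|intpart N|).
move=> B pM p2 p1 p bad g1 g2 mono.
have s1 : B <= 4 * N * p2.
  by apply: leq_trans bad _; rewrite -mulnA;
    apply: leq_trans (leq_mul (leqnn 2) (leq_mul (leqnn _) mono)) _; nia.
have s2 : p2 * L ^ 2 <= 2 * N * p1.
  by apply: leq_trans g1 _; rewrite leq_mul2r leq_mul2l leq_subr !orbT.
apply: (@leq_trans (4 * N * (p2 * L ^ 2) * L ^ 2)).
  by rewrite (_ : 4 = 2 + 2) // [L ^ (2 + 2)]expnD !mulnA !leq_mul2r s1 !orbT.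
apply: (@leq_trans (4 * N * (2 * N * p1) * L ^ 2)).
  by rewrite leq_mul2r leq_mul2l s2 !orbT.
apply: (@leq_trans (8 * N ^ 2 * (2 * N * p))); last first.
  by rewrite !expnS expn0; lia.
apply: (@leq_trans (8 * N ^ 2 * (p1 * L ^ 2))).
  by rewrite !expnS expn0; lia.
by rewrite leq_mul2l g2 orbT.
Qed.

End Partitions.

(** * Few degrees have a small valuation *)

Lemma logn_char_degree_ge n (l : intpart n) q i :
    prime q -> (head 0 (parts l) + size (parts l) < q ^ i.+1)%N ->
  (n %/ q ^ i.+1 <= logn q (char_degree l))%N.
Proof.
by move=> pq lt; rewrite -pfactor_dvdn ?char_degree_gt0 ?char_degree_dvd.
Qed.

(** With t = [trunc_log q n], take Q = q^(t - s), so that n / Q >= q^s. As n < q^(t + 1), the ratio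
    n^3 / Q^4 is at most q^3 q^(4 s - t), and 8 s <= t bounds this by q^3 / q^(4 s). *)
Lemma card_small_logn q n (s := (trunc_log q n %/ 8)%N) :
    prime q -> (q ^ 3 <= n)%N ->
  (#|[pred l : intpart n | (logn q (char_degree l) < q ^ s)%N]| * q ^ (4 * s)
     <= 2 ^ 16 * q ^ 3 * #|intpart n|)%N.
Proof.
move=> pq le_n; have q1 := prime_gt1 pq; have q0 := prime_gt0 pq.
have n0 : (0 < n)%N by apply: leq_trans le_n; rewrite expn_gt0 q0.
set t := trunc_log q n in s *.
have t3 : (3 <= t)%N by rewrite -(trunc_expnK 3 q1) leq_trunc_log.
have nt : (q ^ t <= n)%N by apply: trunc_logP.
have tn : (n < q ^ t.+1)%N by apply: trunc_log_ltn.
have st : (8 * s <= t)%N by rewrite mulnC leq_trunc_div.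
(* An exponent of at least 2 gives Q >= 4, so that [Q %/ 4] is not 0. *)
have [i iE] : exists i, (t - s = i.+2)%N by exists (t - s - 2)%N; lia.
set Q := (q ^ i.+2)%N.
have Q4 : (4 <= Q)%N.
  by apply: (@leq_trans (q ^ 2)); [exact: (leq_mul q1 q1) | rewrite leq_exp2l].
have QE : (Q * q ^ s = q ^ t)%N by rewrite -expnD; congr (_ ^ _)%N; lia.
have Qn : (Q <= n)%N by apply: leq_trans nt; rewrite -QE leq_pmulr ?expn_gt0 ?q0.
have Qk : (q ^ s <= n %/ Q)%N by rewrite leq_divRL 1?mulnC ?QE //; lia.
set B := #|_|.
have badB : (B <= #|[pred l : intpart n |
    (Q %/ 2 <= head 0 (parts l)) || (Q %/ 2 <= size (parts l))]|)%N.
  apply/subset_leq_card/subsetP => l; rewrite !inE => lt; apply: contraLR lt.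
  (* If both lengths are below [Q %/ 2], their sum is below [Q]. *)
  rewrite negb_or -!ltnNge ltnS => /andP[h1 h2].
  by apply: leq_trans Qk _; apply: logn_char_degree_ge => //; rewrite -/Q; lia.
have := @card_large_parts n (Q %/ 2) (Q %/ 4) n0.
move=> /(_ ltac:(lia) ltac:(lia)) bound.
(* Rounding down costs at most a factor 2; the final constant is 8^4 * 16 = 2^16. *)
have L8 : (Q <= 8 * (Q %/ 4))%N by lia.
have BQ : (B * Q ^ 4 <= 2 ^ 16 * n ^ 3 * #|intpart n|)%N.
  apply: (@leq_trans (8 ^ 4 * (B * (Q %/ 4) ^ 4))%N).
    by rewrite mulnCA -expnMn leq_mul2l leq_exp2r // L8 orbT.
  have -> : (2 ^ 16 = 8 ^ 4 * 16)%N.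
    by rewrite -[8%N]/(2 ^ 3)%N -[16%N]/(2 ^ 4)%N -expnM -expnD.
  move: (8 ^ 4)%N => c; rewrite -(mulnA c 16) -(mulnA c) leq_mul2l; apply/orP; right.
  by apply: leq_trans bound; rewrite leq_mul2r badB orbT.
have qQ : (q ^ (3 * t) * q ^ (4 * s) <= Q ^ 4)%N.
  rewrite -expnD -expnM leq_exp2l //; lia.
have n3 : (n ^ 3 <= q ^ 3 * q ^ (3 * t))%N.
  rewrite -expnD (_ : 3 + 3 * t = t.+1 * 3)%N; last by lia.
  by rewrite expnM leq_exp2r // ltnW.
rewrite -(@leq_pmul2l (q ^ (3 * t))) ?expn_gt0 ?q0 //.
apply: (@leq_trans (B * Q ^ 4)%N); first by rewrite mulnCA leq_mul2l qQ orbT.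
apply: leq_trans BQ _; rewrite mulnA leq_mul2r; apply/orP; right.
rewrite mulnCA leq_mul2l; apply/orP; right.
by rewrite mulnC.
Qed.

(** Split 2^s into two powers with exponents about s / 2, each larger than its exponent: the product
    beats s (s + 1) / 4. *)
Lemma affine_lt_exp2 K s : (4 * K <= s)%N -> (K * s.+1 < 2 ^ s)%N.
Proof.
move=> Ks; have := ltn_expl (s %/ 2) (ltnSn 1); have := ltn_expl (s - s %/ 2) (ltnSn 1).
have -> : (2 ^ s = 2 ^ (s %/ 2) * 2 ^ (s - s %/ 2))%N.
  by rewrite -expnD subnKC // leq_div.
by move: (2 ^ _)%N (2 ^ _)%N => a b;
  have := divn_eq s 2; have := ltn_pmod s (ltn0Sn 1); nia.
Qed.

Lemma card_intpart_gt0 n : (0 < #|intpart n|)%N.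
Proof.
have [||l _] := @intpart_of_seq n (nseq n 1); first by rewrite mem_nseq andbF.
  by rewrite sumn_nseq mul1n.
by apply/card_gt0P; exists l.
Qed.

(* Passage to the limit *)
From mathcomp Require Import all_classical all_reals all_analysis.
Import Order.TTheory GRing.Theory Num.Theory numFieldNormedType.Exports.
Local Open Scope classical_set_scope.
Local Open Scope ring_scope.

Theorem theoremA (R : realType) (q m : nat) (hq : prime q) :
  (fun n : nat =>
     #|[pred l : intpart n |
         (logn q (char_degree l))%:R
           <= m%:R + (q%:R - 1) * (ln n%:R / ln q%:R) :> R]|%:R
       / #|intpart n|%:R : R) @ \oo --> (0 : R).
Proof.
apply/cvgrPdist_lt => e e0.
have q1 := prime_gt1 hq; have q0 := prime_gt0 hq.
(* [C] is the constant of [card_small_logn], and [K * s.+1] will bound m + (q - 1) log_q n. The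
   threshold on n forces s > [s0], hence both s >= 4 K and s > C / e. *)
pose C := (2 ^ 16 * q ^ 3)%N; pose K := (m + 8 * q)%N.
pose s0 := (4 * K + (Num.truncn (C%:R / e)).+1)%N.
exists (q ^ (8 * s0.+1))%N => // n /= le_n.
pose t := trunc_log q n; pose s := (t %/ 8)%N.
have n3 : (q ^ 3 <= n)%N by apply: leq_trans le_n; rewrite leq_exp2l //; lia.
have n0 : (0 < n)%N by apply: leq_trans n3; rewrite expn_gt0 q0.
have t0 : (8 * s0.+1 <= t)%N by rewrite -(trunc_expnK (8 * s0.+1) q1) leq_trunc_log.
have s0s : (s0 < s)%N by rewrite leq_divRL // mulnC.
have tn : (n < q ^ t.+1)%N by apply: trunc_log_ltn.
(* Hence log_q n < t + 1 <= 8 (s + 1). *)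
have ts : (t.+1 <= 8 * s.+1)%N by have := ltn_ceil t (isT : 0 < 8)%N; rewrite -/s; lia.
set S := [pred l : intpart n | _].
have leS : (#|S| <= #|[pred l : intpart n | (logn q (char_degree l) < q ^ s)%N]|)%N.
  apply/subset_leq_card/fintype.subsetP => l; rewrite !inE => le_l.
  have lnq : 0 < ln (q%:R : R) by rewrite ln_gt0 // ltr1n.
  have le_ln : ln (n%:R : R) / ln q%:R <= (8 * s.+1)%:R.
    rewrite ler_pdivrMr // mulr_natl -lnXn ?ltr0n // -natrX ler_ln
      ?posrE ?ltr0n ?expn_gt0 ?q0 //.
    by rewrite ler_nat (leq_trans (ltnW tn)) // leq_exp2l.
  have : (logn q (char_degree l))%:R <= (m + q * (8 * s.+1))%:R :> R.
    apply: le_trans le_l _; rewrite natrD lerD2l natrM.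
    apply: ler_pM => //; rewrite ?subr_ge0 ?ler1n ?gerBl //.
    by rewrite divr_ge0 ?ln_ge0 ?ler1n // ltnW.
  rewrite ler_nat => /leq_ltn_trans; apply.
  apply: (@leq_ltn_trans (K * s.+1)); first by rewrite /K; lia.
  apply: (@leq_trans (2 ^ s)); first by apply: affine_lt_exp2; rewrite /s0 in s0s; lia.
  by rewrite leq_exp2r //; lia.
have SC : (#|S| * q ^ (4 * s) <= C * #|intpart n|)%N.
  by apply: leq_trans (card_small_logn hq n3); rewrite leq_mul2r leS orbT.
rewrite sub0r normrN ger0_norm ?divr_ge0 // ltr_pdivrMr ?ltr0n ?card_intpart_gt0 //.
(* The proportion is at most C / q^(4 s), and q^(4 s) > s > C / e. *)
have qs : C%:R < e * (q ^ (4 * s))%:R.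
  rewrite -ltr_pdivrMl // mulrC; apply: lt_trans (truncnS_gt _) _.
  rewrite ltr_nat; apply: (@ltn_trans s); first exact: leq_ltn_trans (leq_addl _ _) s0s.
  by apply: leq_ltn_trans (ltn_expl (4 * s) q1); lia.
have qp : 0 < (q ^ (4 * s))%:R :> R by rewrite ltr0n expn_gt0 q0.
rewrite -(ltr_pM2r qp) -natrM; apply: (@le_lt_trans _ _ (C * #|intpart n|)%:R).
  by rewrite ler_nat.
by rewrite natrM mulrAC ltr_pM2r // ltr0n card_intpart_gt0.
Qed.
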